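(* For every prime $p\ge 7$ there exists a connected threshold graph $\mathcal{G}$ with $p^2$ vertices such that $$E(\Gamma(\mathbb{Z}/p^2\mathbb{Z}))<E(\mathcal{G})<E(K_{p^2}).$$
   Context: For a finite abelian group $G$ viewed as a $\mathbb{Z}$-module and $x\in G$, $[x:G]=\{r\in\mathbb{Z} : rG\subseteq\mathbb{Z}x\}$. The group-annihilator graph $\Gamma(G)$ has vertex set $G$, with distinct $x,y$ adjacent iff $[x:G][y:G]G=\{0\}$ (product of ideals of $\mathbb{Z}$). A threshold graph is a graph obtained from a single vertex by repeatedly adding an isolated vertex or a dominating vertex. The energy $E(\mathcal{G})$ of a graph is the sum of the absolute values of the eigenvalues of its adjacency matrix; $K_n$ is the complete graph on $n$ vertices (so $E(K_n)=2(n-1)$). *)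

(* Defs.v *)
From HB Require Import structures.
From mathcomp Require Import all_boot all_order all_algebra all_field.
From mathcomp Require Import boolp classical_sets.

Set Implicit Arguments.
Unset Strict Implicit.
Unset Printing Implicit Defensive.

Import Order.TTheory GRing.Theory Num.Theory.
Local Open Scope ring_scope.

Record sgraph := SGraph {
  vertex :> finType;
  adj : rel vertex;
  adj_sym : symmetric adj;
  adj_irr : irreflexive adj }.

Definition connected (G : sgraph) : Prop :=
  (0 < #|G|)%N /\ forall x y : G, connect (@adj G) x y.

Lemma neq_sym (T : eqType) : symmetric (fun x y : T => x != y).
Proof. by move=> x y; rewrite eq_sym. Qed.

Lemma neq_irr (T : eqType) : irreflexive (fun x y : T => x != y).
Proof. by move=> x; rewrite eqxx. Qed.

Definition complete_graph (n : nat) : sgraph :=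
  SGraph (@neq_sym 'I_n) (@neq_irr 'I_n).

(* [threshold_on A] says that the subgraph of [G] induced on [A] is built from
   a single vertex by successively adding a vertex [v] that is isolated from,
   or adjacent to, all the vertices present so far. *)
Inductive threshold_on (G : sgraph) : {set G} -> Prop :=
| threshold_single (v : G) : threshold_on [set v]
| threshold_isolated (A : {set G}) (v : G) :
    threshold_on A -> v \notin A -> (forall u, u \in A -> ~~ adj v u) ->
    threshold_on (v |: A)
| threshold_dominating (A : {set G}) (v : G) :
    threshold_on A -> v \notin A -> (forall u, u \in A -> adj v u) ->
    threshold_on (v |: A).

Definition threshold (G : sgraph) : Prop := threshold_on [set: G].

Definition adjacency_matrix (G : sgraph) : 'M[algC]_#|G| :=
  \matrix_(i, j) (adj (enum_val i) (enum_val j))%:R.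

(* Eigenvalues are listed with their algebraic multiplicities. *)
Definition eigenvalues (n : nat) (A : 'M[algC]_n) : seq algC :=
  sval (closed_field_poly_normal (char_poly A)).

Lemma eigenvaluesP (n : nat) (A : 'M[algC]_n) :
  char_poly A = \prod_(z <- eigenvalues A) ('X - z%:P).
Proof.
rewrite /eigenvalues; case: closed_field_poly_normal => s /= {1}->.
by rewrite (monicP (char_poly_monic A)) scale1r.
Qed.

(* The order of [algC] restricted to its real elements, such as energies, is
   the usual one. *)
Definition energy (G : sgraph) : algC :=
  \sum_(z <- eigenvalues (adjacency_matrix G)) `|z|.

(* [x : G] = {r in Z | r G is contained in Z x} *)
Definition group_colon (G : zmodType) (x : G) : set int :=
  [set r | forall g : G, exists k : int, g *~ r = x *~ k].

Definition ideal_mul (I J : set int) : set int :=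
  [set s | exists (n : nat) (a b : 'I_n -> int),
     [/\ forall i, I (a i), forall i, J (b i) & s = \sum_i a i * b i]].

Definition ideal_act (G : zmodType) (I : set int) : set G :=
  [set h | exists (n : nat) (r : 'I_n -> int) (g : 'I_n -> G),
     (forall i, I (r i)) /\ h = \sum_i g i *~ r i].

Arguments ideal_act : clear implicits.

Definition annihilator_adj (G : finZmodType) : rel G := fun x y =>
  (x != y) &&
  `[< ideal_act G (ideal_mul (group_colon x) (group_colon y)) = [set 0]%classic >].

Lemma ideal_mulC (I J : set int) : ideal_mul I J = ideal_mul J I.
Proof.
rewrite /ideal_mul; apply/seteqP; split=> s /= [n [a [b [Ia Jb ->]]]];
  by exists n, b, a; split=> //; apply: eq_bigr => i _; rewrite mulrC.
Qed.

Lemma annihilator_adj_sym (G : finZmodType) : symmetric (@annihilator_adj G).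
Proof. by move=> x y; rewrite /annihilator_adj eq_sym ideal_mulC. Qed.

Lemma annihilator_adj_irr (G : finZmodType) : irreflexive (@annihilator_adj G).
Proof. by move=> x; rewrite /annihilator_adj eqxx. Qed.

Definition annihilator_graph (G : finZmodType) : sgraph :=
  SGraph (@annihilator_adj_sym G) (@annihilator_adj_irr G).

(* Main.v *)
(* The witness is K_n minus an edge, with n = p^2.  For a graph with adjacency
   matrix A, the multiplicity of the eigenvalue -1 is n - rank (A + 1); since the
   eigenvalues sum to 0, the energy is at least 2 (n - rank (A + 1)), which is
   2 (n - 1) for K_n and at least 2 (n - 3) for K_n minus an edge.  The latter
   has three other eigenvalues, one of them 0, and its trace and number of edges
   bound the remaining two well enough to keep its energy below 2 (n - 1).  In
   the graph of Z/p^2, adjacent vertices are both multiples of p unless one of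
   them is 0, so there are at most 3 n ordered pairs of adjacent vertices and
   McClelland's bound gives an energy of at most sqrt 3 * n < 2 (n - 3). *)
Require Import Defs.
From mathcomp Require Import all_boot all_order all_algebra all_field.
From mathcomp Require Import boolp.
From mathcomp Require Import zify ring.
Import Order.TTheory GRing.Theory Num.Theory.
Local Open Scope ring_scope.

(** * Spectrum of a real symmetric matrix *)

(** Selecting the nonzero diagonal entries and dividing by them turns [diag_mx d] into an identity
    matrix, and multiplication cannot raise the rank. *)
Lemma supp_leq_rank_diag {F : fieldType} {n : nat} (d : 'rV[F]_n) :
  (#|[set i | d 0 i != 0]%R| <= \rank (diag_mx d))%N.
Proof.
set S := [set i | _].
pose L : 'M[F]_(#|S|, n) := \matrix_(i, j) ((j == enum_val i)%:R / d 0 j).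
pose C : 'M[F]_(n, #|S|) := \matrix_(j, i) (j == enum_val i)%:R.
have LdC : L *m diag_mx d *m C = 1%:M.
  apply/matrixP => i k; rewrite mul_mx_diag !mxE (bigD1 (enum_val i)) //= big1.
    have := enum_valP i; rewrite inE => di.
    by rewrite !mxE eqxx div1r mulVf // mul1r addr0 (inj_eq enum_val_inj).
  by move=> j /negPf ji; rewrite !mxE ji !mul0r.
rewrite -[X in (X <= _)%N](mxrank1 F) -LdC.
exact: leq_trans (mxrankM_maxl _ _) (mxrankM_maxr _ _).
Qed.

Section RealSymmetricSpectrum.
Variables (n : nat) (A : 'M[algC]_n).
Hypotheses (symA : A^T = A) (realA : A \is a mxOver Num.real).

Let d := spectral_diag A.
Let P := spectralmx A.

Let hermA : A \is hermsymmx.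
Proof.
apply: realsym_hermsym realA.
by apply/is_hermitianmxP; rewrite expr0 scale1r map_mx_id.
Qed.

Let spectralE : A = invmx P *m diag_mx d *m P.
Proof. exact/orthomx_spectralP/hermitian_normalmx. Qed.

Let unitP : P \in unitmx. Proof. exact: spectral_unit. Qed.

Lemma spectral_real i : d 0 i \is Num.real.
Proof. exact: (mxOverP (hermitian_spectral_diag_real hermA)). Qed.

Lemma char_poly_spectral : char_poly A = \prod_i ('X - (d 0 i)%:P).
Proof.
have -> : char_poly A = char_poly (diag_mx d).
  rewrite /char_poly /char_poly_mx.
  set Q := map_mx polyC P; set D := map_mx polyC (diag_mx d).
  have Qunit : Q \in unitmx by rewrite map_unitmx.
  rewrite spectralE !map_mxM map_invmx -/Q -/D.
  have -> : 'X%:M - invmx Q *m D *m Q = invmx Q *m ('X%:M - D) *m Q.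
    by rewrite mulmxBr mulmxBl mul_mx_scalar -scalemxAl mulVmx // scalemx1.
  by rewrite !det_mulmx mulrC mulrA -det_mulmx mulmxV // det1 mul1r.
rewrite char_poly_trig ?diag_mx_is_trig //.
by apply: eq_bigr => i _; rewrite mxE eqxx.
Qed.

(** Both lists of roots factor the characteristic polynomial, hence agree up to permutation; this
    makes the spectral theorem available for [energy]. *)
Lemma sum_norm_eigenvalues : \sum_(z <- eigenvalues A) `|z| = \sum_i `|d 0 i|.
Proof.
have /prod_XsubC_eq/(perm_big _) -> :
    \prod_(z <- eigenvalues A) ('X - z%:P) =
    \prod_(z <- [seq d 0 i | i : 'I_n]) ('X - z%:P).
  by rewrite -eigenvaluesP big_image char_poly_spectral.
by rewrite big_image.
Qed.

Lemma trace_spectral : \sum_i d 0 i = \tr A.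
Proof. by rewrite spectralE mxtrace_mulC mulmxA mulmxV // mul1mx mxtrace_diag. Qed.

Lemma trace_sqr_spectral : \sum_i d 0 i ^+ 2 = \tr (A *m A).
Proof.
rewrite {1 2}spectralE -!mulmxA mulKVmx // mxtrace_mulC -!mulmxA mulmxV //.
rewrite mulmx1 mulmx_diag mxtrace_diag.
by apply: eq_bigr => i _; rewrite mxE.
Qed.

Lemma det_spectral : \det A = \prod_i d 0 i.
Proof.
rewrite spectralE !det_mulmx mulrC mulrA -det_mulmx mulmxV //.
by rewrite det1 mul1r det_diag.
Qed.

(** [A - c] is conjugate to the diagonal matrix with entries [d 0 i - c], so the two have equal
    rank. *)
Lemma card_spectral_neq c :
  (#|[set i | d 0 i != c]%R| <= \rank (A - c%:M)%R)%N.
Proof.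
have -> : \rank (A - c%:M)%R = \rank (diag_mx (d - const_mx c))%R.
  have -> : A - c%:M = invmx P *m diag_mx (d - const_mx c) *m P.
    rewrite linearB /= diag_const_mx mulmxBr mulmxBl -spectralE mul_mx_scalar.
    by rewrite -scalemxAl mulVmx // scalemx1.
  by rewrite mxrankMfree ?row_free_unit // (eqmxMfull _ _) // row_full_unit unitmx_inv.
apply: leq_trans (supp_leq_rank_diag _).
rewrite (_ : [set i | _] = [set i | (d - const_mx c) 0 i != 0]) //.
by apply/setP => i; rewrite !inE !mxE subr_eq0.
Qed.

End RealSymmetricSpectrum.

(** * Energy of a graph through its spectrum *)

Section GraphSpectrum.
Variable G : sgraph.
Let A := adjacency_matrix G.
Let d := spectral_diag A.

Lemma tr_adjacency : A^T = A.
Proof. by apply/matrixP => i j; rewrite !mxE adj_sym. Qed.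

Lemma real_adjacency : A \is a mxOver Num.real.
Proof. by apply/mxOverP => i j; rewrite mxE realn. Qed.

Let symA := tr_adjacency.
Let realA := real_adjacency.

Lemma energy_spectral : energy G = \sum_i `|d 0 i|.
Proof. exact: sum_norm_eigenvalues. Qed.

Lemma sum_adjacency_spectral : \sum_i d 0 i = 0.
Proof.
by rewrite (trace_spectral _ _ symA realA) /mxtrace big1 // => i _; rewrite mxE adj_irr.
Qed.

(** The trace of the squared adjacency matrix counts closed walks of length two, that is, ordered
    adjacent pairs. *)
Lemma sum_sqr_adjacency_spectral :
  \sum_i d 0 i ^+ 2 = (\sum_(x : G) \sum_(y : G) adj x y)%:R.
Proof.
rewrite (trace_sqr_spectral _ _ symA realA) /mxtrace natr_sum.
have bijG : bijective (fun i : 'I_#|G| => enum_val i : G) := enum_val_bij _.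
rewrite [RHS](reindex _ (onW_bij _ bijG)) /=.
apply: eq_bigr => i _; rewrite mxE natr_sum.
rewrite [RHS](reindex _ (onW_bij _ bijG)) /=.
apply: eq_bigr => j _; rewrite !mxE [in X in _ * X]adj_sym -natrM.
by case: adj.
Qed.

(* McClelland's bound, i.e. Cauchy-Schwarz for the eigenvalues. *)
Lemma energy_sqr_le :
  energy G ^+ 2 <= (#|G| * \sum_(x : G) \sum_(y : G) adj x y)%:R.
Proof.
rewrite natrM -sum_sqr_adjacency_spectral energy_spectral.
(* Lagrange's identity: after doubling, the two sides differ by the sum over [i] and [j] of the
   squares of [|d_i| - |d_j|]. *)
rewrite -(ler_pM2l (x := 2)) // expr2 big_distrlr /= mulr_sumr.
have -> : 2 * (#|G|%:R * \sum_i d 0 i ^+ 2) =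
    \sum_i \sum_j (d 0 i ^+ 2 + d 0 j ^+ 2).
  under [RHS]eq_bigr do rewrite big_split /= sumr_const card_ord.
  rewrite big_split /= sumr_const card_ord sumrMnl.
  by rewrite -[in RHS]mulr_natl; ring.
apply: ler_sum => i _; rewrite mulr_sumr; apply: ler_sum => j _.
have di := spectral_real _ _ symA realA i; have dj := spectral_real _ _ symA realA j.
rewrite -subr_ge0 -(real_normK di) -(real_normK dj).
set a := `|_ i|; set b := `|_ j|.
have -> : a ^+ 2 + b ^+ 2 - 2 * (a * b) = (a - b) ^+ 2 by ring.
by rewrite -realEsqr rpredB // normr_real.
Qed.

(** At least [#|G| - r] eigenvalues are -1. The trace is 0, so the others sum to the number of
    these, and each group contributes at least [#|G| - r]. *)
Lemma energy_ge (r : nat) :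
  (\rank (A + 1%:M)%R <= r)%N -> (2 * (#|G| - r))%:R <= energy G.
Proof.
move=> rkA; set S := [set i | d 0 i != -1].
have Sr : (#|G| - r <= #|~: S|)%N.
  rewrite cardsCs setCK card_ord leq_sub2l // (leq_trans _ rkA) //.
  have := card_spectral_neq _ _ symA realA (-1).
  by rewrite rmorphN opprK.
have dS i : i \in ~: S -> d 0 i = -1 by rewrite !inE negbK => /eqP.
have sumS : \sum_(i in S) d 0 i = #|~: S|%:R.
  have := sum_adjacency_spectral; rewrite (bigID (mem S)) /=.
  rewrite [X in _ + X](eq_bigl (mem (~: S))); last by move=> i; rewrite !inE.
  rewrite [X in _ + X](eq_bigr (fun=> -1)); last by move=> i /dS.
  by rewrite sumr_const mulNrn => /eqP; rewrite subr_eq0 => /eqP.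
rewrite energy_spectral (bigID (mem S)) /=.
rewrite [X in _ + X](eq_bigl (mem (~: S))); last by move=> i; rewrite !inE.
rewrite [X in _ + X](eq_bigr (fun=> 1)); last by move=> i /dS ->; rewrite normrN1.
rewrite sumr_const mul2n -addnn natrD; apply: lerD; last by rewrite ler_nat.
apply: le_trans (ler_norm_sum _ _ _).
by rewrite sumS ger0_norm // ler_nat.
Qed.

End GraphSpectrum.

(* The last two eigenvalues a and b have a + b = n - 3 and a^2 + b^2 = (n - 1)^2,
   so that ab = 4 - 2n and (|a| + |b|)^2 = n^2 + 2n - 7 < (n + 1)^2. *)
Lemma sum_norm_near_complete (n : nat) (d : 'I_n -> algC) (i0 : 'I_n) :
    (3 <= n)%N -> (forall i, d i \is Num.real) -> d i0 = 0 ->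
    (#|[set i | d i != -1]%R| <= 3)%N ->
    \sum_i d i = 0 -> \sum_i d i ^+ 2 = (n * n.-1 - 2)%:R ->
  \sum_i `|d i| < (2 * n.-1)%:R.
Proof.
move=> n3 dR d0 S3 sum_d sum_d2; set S := [set i | _] in S3.
have Si0 : i0 \in S by rewrite inE d0 eq_sym oppr_eq0 oner_eq0.
set T := S :\ i0; have T2 : (#|T| <= 2)%N by move: S3; rewrite (cardsD1 i0) Si0.
have cardT : #|~: S| = (n - 1 - #|T|)%N.
  by have := cardsC S; rewrite (cardsD1 i0) Si0 card_ord -/T; lia.
(* Used for the identity, the square and the norm, that is, for the trace, the edge count and the
   energy. *)
have split_sum (F : algC -> algC) :
    \sum_i F (d i) = F 0 + \sum_(i in T) F (d i) + F (-1) *+ (n - 1 - #|T|).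
  rewrite (bigID (mem S)) /= (bigD1 i0) //= d0; congr (_ + _ + _).
    by apply: eq_bigl => i; rewrite !inE andbC.
  rewrite -cardT -sumr_const.
  under [LHS]eq_bigl => i do rewrite -in_setC.
  by apply: eq_bigr => i; rewrite !inE negbK => /eqP ->.
have := split_sum id; have := split_sum (fun x => x ^+ 2).
rewrite sum_d sum_d2 (split_sum (fun x => `|x|)) /=.
rewrite normr0 expr0n normrN1 sqrrN expr1n !add0r.
have [m nE] : exists m, n = m.+3 by exists (n - 3)%N; lia.
move: T2; rewrite leq_eqVlt ltnS leq_eqVlt ltnS leqn0.
case/or3P => [/cards2P [a [b [ab ->]]]|/cards1P [a ->]|/eqP/cards0_eq ->].
- rewrite !big_setU1 ?inE // !big_set1 cards2 ab.
  have -> : (n - 1 - 2 = m)%N by lia.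
  have -> : (n * n.-1 - 2 = m * m + 5 * m + 4)%N by rewrite nE; lia.
  have -> : (2 * n.-1 = m + (m + 4))%N by rewrite nE; lia.
  move: (d a) (d b) (dR a) (dR b) => x y xR yR.
  rewrite mulNrn => sqE /esym/eqP; rewrite subr_eq0 => /eqP abE.
  have {}sqE : x ^+ 2 + y ^+ 2 = (m%:R + 2) ^+ 2.
    have := congr1 (fun z => z - m%:R) sqE; rewrite addrK => <-.
    by rewrite !natrD !natrM; ring.
  have prodE : x * y = - (2 * (m%:R + 1)).
    apply: (mulfI (x := 2)); first by rewrite pnatr_eq0.
    have -> : 2 * (x * y) = (x + y) ^+ 2 - (x ^+ 2 + y ^+ 2) by ring.
    by rewrite abE sqE; ring.
  rewrite addrC natrD ltrD2l -(ltr_pXn2r (n := 2)) ?nnegrE ?addr_ge0 //.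
  have -> : (`|x| + `|y|) ^+ 2 = (`|x| ^+ 2 + `|y| ^+ 2) + 2 * (`|x| * `|y|) by ring.
  rewrite !real_normK // sqE -normrM prodE normrN ger0_norm; last first.
    by rewrite mulr_ge0 // addr_ge0.
  rewrite -subr_gt0.
  have -> : (m + 4)%:R ^+ 2 - ((m%:R + 2) ^+ 2 + 2 * (2 * (m%:R + 1))) = 8 :> algC.
    by rewrite natrD; ring.
  by rewrite ltr0n.
(* With one eigenvalue left, the trace makes it [n - 2] and the sum of norms [2 (n - 2)]; with none
   left, the trace could not vanish. *)
- rewrite !big_set1 cards1 mulNrn => _ /esym/eqP; rewrite subr_eq0 => /eqP ->.
  by rewrite normr_nat -mulrnDr ltr_nat nE; lia.
rewrite !big_set0 cards0 !add0r mulNrn => _ /eqP.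
by rewrite eq_sym oppr_eq0 pnatr_eq0 nE; lia.
Qed.

(** * The complete graph, with and without an edge *)

Lemma mxrank_cvMrv (F : fieldType) (m n : nat) (u : 'cV[F]_m) (v : 'rV[F]_n) :
  (\rank (u *m v) <= 1)%N.
Proof. exact: leq_trans (mxrankM_maxl _ _) (rank_leq_col _). Qed.

Lemma energy_complete_graph_ge (n : nat) :
  (2 * n.-1)%:R <= energy (complete_graph n).
Proof.
have -> : n.-1 = (#|complete_graph n| - 1)%N by rewrite card_ord subn1.
apply: energy_ge.
have -> : adjacency_matrix (complete_graph n) + 1%:M =
    const_mx 1 *m (const_mx 1 : 'rV_#|complete_graph n|).
  apply/matrixP => i j; rewrite !mxE big_ord1 !mxE mulr1 /= (inj_eq enum_val_inj).
  by case: (i == j); rewrite ?addr0 ?add0r.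
exact: mxrank_cvMrv.
Qed.

(* The complete graph on m.+2 vertices, without the edge between 0 and 1. *)
Definition near_complete_adj (m : nat) : rel 'I_m.+2 :=
  fun x y => (x != y) && ((1 < x) || (1 < y))%N.

Lemma near_complete_sym m : symmetric (near_complete_adj m).
Proof. by move=> x y; rewrite /near_complete_adj eq_sym orbC. Qed.

Lemma near_complete_irr m : irreflexive (near_complete_adj m).
Proof. by move=> x; rewrite /near_complete_adj eqxx. Qed.

Definition near_complete_graph (m : nat) : sgraph :=
  SGraph (near_complete_sym m) (near_complete_irr m).

(** With at least three vertices, [ord_max] exceeds 1 and is adjacent to every other vertex, so
    paths can run through it. *)
Lemma connected_near_complete (m : nat) : connected (near_complete_graph m.+1).
Proof.
split=> [|x y]; first by rewrite card_ord.
have top (z : near_complete_graph m.+1) : connect (@adj _) z ord_max.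
  have [->|zm] := eqVneq z ord_max; first exact: connect0.
  by apply: connect1; rewrite /= /near_complete_adj zm /= orbT.
apply: connect_trans (top x) _; rewrite sym_connect_sym; first exact: top.
exact: adj_sym.
Qed.

(** Vertices are added in increasing order: 1 is isolated from 0, and each later one dominates. *)
Lemma threshold_near_complete (m : nat) : threshold (near_complete_graph m).
Proof.
pose V := near_complete_graph m.
suff H k : (k < m.+2)%N -> @threshold_on V [set i : V | (i <= k)%N].
  rewrite /threshold (_ : [set: _] = [set i : V | (i <= m.+1)%N]); first exact: H.
  by apply/setP => i; rewrite !inE -ltnS ltn_ord.
elim: k => [|k IHk] km.
  rewrite (_ : [set i : V | _] = [set ord0 : V]); first exact: threshold_single.
  by apply/setP => i; rewrite !inE leqn0.
pose v : V := Ordinal km.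
have -> : [set i : V | (i <= k.+1)%N] = v |: [set i : V | (i <= k)%N].
  by apply/setP => i; rewrite !inE leq_eqVlt ltnS.
have vk : v \notin [set i : V | (i <= k)%N] by rewrite inE /= ltnn.
case: k km IHk @v vk => [|k] km IHk v vk.
  apply: threshold_isolated => // [|u]; first exact/IHk/ltnW.
  by rewrite inE leqn0 /= /near_complete_adj => /eqP ->; rewrite andbF.
apply: threshold_dominating => // [|u]; first exact/IHk/ltnW.
rewrite inE /= /near_complete_adj /= andbT => uk.
by rewrite neq_ltn /= ltnS uk orbT.
Qed.

(** Adjacency, identity and the missing edge in both directions add up to the all-ones matrix. The
    additive form avoids truncated subtraction and serves both the edge count and the rank bound. *)
Lemma near_complete_adjE (m : nat) (x y : 'I_m.+2) :
  (near_complete_adj m x y + (x == y) + (x == 0 :> nat) * (y == 1 :> nat)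
    + (x == 1 :> nat) * (y == 0 :> nat) = 1)%N.
Proof.
rewrite /near_complete_adj -val_eqE /=.
case: x y => [[|[|x]] hx] [[|[|y]] hy] //=.
by rewrite !eqSS; case: (x == y).
Qed.

Lemma sum_eq_ord (m k : nat) : (k < m)%N -> (\sum_(x < m) (x == k :> nat) = 1)%N.
Proof.
move=> km; rewrite (bigD1 (Ordinal km)) //= eqxx big1 // => x.
by rewrite -val_eqE => /negPf ->.
Qed.

Lemma sum_near_complete (m : nat) :
  (\sum_(x : near_complete_graph m) \sum_(y : near_complete_graph m) adj x y =
   m.+2 * m.+1 - 2)%N.
Proof.
have row_sum (x : 'I_m.+2) :
    (\sum_(y < m.+2) near_complete_adj m x y + 1 + (x == 0 :> nat) + (x == 1 :> nat) =
     m.+2)%N.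
  have : (\sum_(y < m.+2) (near_complete_adj m x y + (x == y)
      + (x == 0 :> nat) * (y == 1 :> nat)
      + (x == 1 :> nat) * (y == 0 :> nat)) = m.+2)%N.
    by under eq_bigr do rewrite near_complete_adjE; rewrite sum1_card card_ord.
  rewrite !big_split /= -!big_distrr /= !sum_eq_ord // !muln1.
  suff -> : (\sum_(y < m.+2) (x == y) = 1)%N by [].
  by rewrite (bigD1 x) //= eqxx big1 // => y /negPf; rewrite eq_sym => ->.
have : (\sum_(x < m.+2) (\sum_(y < m.+2) near_complete_adj m x y + 1
    + (x == 0 :> nat) + (x == 1 :> nat)) = m.+2 * m.+2)%N.
  by under eq_bigr do rewrite row_sum; rewrite sum_nat_const card_ord.
rewrite !big_split /= !sum_eq_ord //.
by rewrite sum1_card card_ord; nia.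
Qed.

(** Vertices 0 and 1 have the same neighbours, so their rows coincide. *)
Lemma det_near_complete (m : nat) : \det (adjacency_matrix (near_complete_graph m)) = 0.
Proof.
pose V := near_complete_graph m.
pose o0 : V := Ordinal (isT : 0 < m.+2)%N; pose o1 : V := Ordinal (isT : 1 < m.+2)%N.
apply: (determinant_alternate (i1 := enum_rank o0) (i2 := enum_rank o1)) => [|j].
  by rewrite (inj_eq enum_rank_inj).
rewrite !mxE !enum_rankK /= /near_complete_adj /= -!val_eqE /=.
by case: (enum_val j) => [[|[|k]] hk].
Qed.

(** The matrix is the all-ones matrix minus two elementary matrices, each of the three having rank
    at most one. *)
Lemma rank_near_complete (m : nat) :
  (\rank (adjacency_matrix (near_complete_graph m) + 1%:M)%R <= 3)%N.
Proof.
pose V := near_complete_graph m.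
pose e k : 'cV[algC]_#|V| := \col_i (nat_of_ord (enum_val i : 'I_m.+2) == k)%:R.
pose j : 'cV[algC]_#|V| := const_mx 1.
have -> : adjacency_matrix V + 1%:M =
    j *m j^T + - e 0%N *m (e 1%N)^T + - e 1%N *m (e 0%N)^T.
  apply/matrixP => i k; rewrite !mxE !big_ord1 !mxE mulr1.
  have := congr1 (GRing.natmul (1 : algC)) (near_complete_adjE m (enum_val i) (enum_val k)).
  rewrite (inj_eq enum_val_inj) !natrD !natrM /= => E.
  by rewrite [X in _ = X + _ + _](esym E); ring.
rewrite (leq_trans (mxrank_add _ _)) // (leq_add (n1 := 2)) ?mxrank_cvMrv //.
by rewrite (leq_trans (mxrank_add _ _)) // (leq_add (n1 := 1)) ?mxrank_cvMrv.
Qed.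

Lemma energy_near_complete_lt (m : nat) :
  energy (near_complete_graph m.+1) < (2 * m.+2)%:R.
Proof.
set V := near_complete_graph m.+1; set A := adjacency_matrix V.
have symA := tr_adjacency V; have realA := real_adjacency V.
have cardV : #|V| = m.+3 by rewrite card_ord.
(* The determinant vanishes, so 0 is an eigenvalue. *)
have /eqP : \prod_i spectral_diag A 0 i = 0.
  by rewrite -(det_spectral _ _ symA realA) det_near_complete.
case/prodf_eq0 => i _ /eqP di0.
rewrite energy_spectral (_ : m.+2 = #|V|.-1) ?cardV //.
apply: (@sum_norm_near_complete _ (spectral_diag A 0) i) => //.
- by rewrite cardV.
- exact: spectral_real.
- have := card_spectral_neq _ _ symA realA (-1); rewrite rmorphN opprK => /leq_trans-> //.
  exact: rank_near_complete.
- exact: sum_adjacency_spectral.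
by rewrite sum_sqr_adjacency_spectral sum_near_complete cardV.
Qed.

Lemma energy_near_complete_ge (m : nat) :
  (2 * m.-1)%:R <= energy (near_complete_graph m).
Proof.
have -> : m.-1 = (#|near_complete_graph m| - 3)%N by rewrite card_ord !subSS subn1.
exact/energy_ge/rank_near_complete.
Qed.

(** * The group-annihilator graph of Z/p^2 *)

(** By Bezout, [n] divides the gcd plus [a * x], so modulo [n] the gcd is a multiple of [x]; hence
    the sign in the witness. *)
Lemma gcdn_group_colon (n : nat) (x : 'Z_n) :
  (1 < n)%N -> group_colon x (gcdn x n)%:Z.
Proof.
move=> n1 g; have [a _ /dvdnP [q aE]] := Bezoutr x (ltnW n1).
exists (- (a * g)%:Z).
have : (q * n)%:R = 0 :> 'Z_n by apply: val_inj; rewrite /= val_Zp_nat // modnMl.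
rewrite -aE natrD natrM natr_Zp => /eqP; rewrite addr_eq0 => /eqP gE.
rewrite -mulrzr mulrNz -!pmulrn gE mulrN -[x *+ _]mulr_natr natrM natr_Zp.
by congr (- _); ring.
Qed.

(** The gcds lie in the two colon ideals, so their product annihilates 1. *)
Lemma annihilator_adj_dvdn (n : nat) (x y : 'Z_n) :
  (1 < n)%N -> annihilator_adj x y -> (n %| gcdn x n * gcdn y n)%N.
Proof.
move=> n1 /andP [_ /asboolP annih].
set a := gcdn x n; set b := gcdn y n.
(* Evaluating the equality of sets at this element reduces its vanishing to a membership, which
   one-term sums witness. *)
have /(congr1 (fun P => P ((1 : 'Z_n) *~ (a%:Z * b%:Z)))) := annih.
rewrite -PoszM => /= H.
have : (1 : 'Z_n) *~ (a * b)%:Z = 0.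
  rewrite -[_ = 0]H; exists 1, (fun=> (a * b)%:Z), (fun=> 1); split.
    move=> _; exists 1, (fun=> a%:Z), (fun=> b%:Z).
    by split=> [_|_|]; rewrite ?big_ord1 ?PoszM //; exact: gcdn_group_colon.
  by rewrite big_ord1.
by rewrite -pmulrn => /(congr1 val); rewrite /= val_Zp_nat // => /eqP.
Qed.

Lemma prime_sqr_gt1 (p : nat) : prime p -> (1 < p ^ 2)%N.
Proof. by move=> pp; rewrite -{1}(exp1n 2) ltn_exp2r ?prime_gt1. Qed.

(** If [p] does not divide one representative, its gcd with [p ^ 2] is 1, so [p ^ 2] divides the
    other, which is smaller and hence 0. *)
Lemma annihilator_adj_Zp2 (p : nat) (x y : 'Z_(p ^ 2)) : prime p ->
  annihilator_adj x y -> [|| (p %| x)%N && (p %| y)%N, x == 0 | y == 0].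
Proof.
move=> pp; have p2 := prime_sqr_gt1 _ pp.
have zero (z : 'Z_(p ^ 2)) : (p ^ 2 %| z)%N -> z == 0.
  move=> /dvdnP [[|k] zE]; first by rewrite -val_eqE /= zE.
  by have := ltn_ord z; rewrite [X in (_ < X)%N]Zp_cast // zE mulSn -ltn_subRL subnn.
have cop (z : 'Z_(p ^ 2)) : ~~ (p %| z)%N -> gcdn z (p ^ 2) = 1%N.
  by rewrite -prime_coprime // coprime_sym => /(coprimeXr 2)/eqP.
move=> /annihilator_adj_dvdn -/(_ p2).
have [px|/cop ->] := boolP (p %| x)%N.
  have [//|/cop ->] := boolP (p %| y)%N.
  by rewrite muln1 => /dvdn_trans/(_ (dvdn_gcdl _ _))/zero ->.
by rewrite mul1n => /dvdn_trans/(_ (dvdn_gcdl _ _))/zero ->; rewrite orbT.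
Qed.

(** A multiple of [p] is determined by its quotient by [p], which is below [p]. *)
Lemma card_dvdn_Zp2 (p : nat) : prime p ->
  (\sum_(x : 'Z_(p ^ 2)) (p %| x) <= p)%N.
Proof.
move=> pp; have p2 := prime_sqr_gt1 _ pp.
pose f (k : 'I_p) : 'Z_(p ^ 2) := (k * p)%:R.
rewrite (eq_bigr (fun x : 'Z_(p ^ 2) => if (p %| x)%N then 1%N else 0%N)); last first.
  by move=> x _; case: ifP.
rewrite -big_mkcond sum1_card -[X in (_ <= X)%N]card_ord.
apply: leq_trans (leq_imset_card f _); apply/subset_leq_card/subsetP => x;
rewrite unfold_in => px.
have xp : (x %/ p < p)%N.
  by rewrite ltn_divLR ?prime_gt0 // mulnn -[X in (_ < X)%N](Zp_cast p2).
by apply/imsetP; exists (Ordinal xp); rewrite // /f /= divnK // natr_Zp.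
Qed.

(** Pairs of multiples of [p] number at most [p * p]; [x = 0] and [y = 0] account for [p ^ 2] pairs
    each. *)
Lemma sum_annihilator_adj_Zp2 (p : nat) : prime p ->
  (\sum_(x : annihilator_graph 'Z_(p ^ 2)) \sum_(y : annihilator_graph 'Z_(p ^ 2)) adj x y
     <= 3 * p ^ 2)%N.
Proof.
move=> pp; have p2 := prime_sqr_gt1 _ pp.
have sum0 : (\sum_(x : 'Z_(p ^ 2)) (x == 0%R) = 1)%N.
  by rewrite (bigD1 (0 : 'Z_(p ^ 2))) //= big1 // => x /negPf ->.
have cardZ : #|'Z_(p ^ 2)| = (p ^ 2)%N by rewrite card_ord Zp_cast.
have : (\sum_(x : 'Z_(p ^ 2)) \sum_(y : 'Z_(p ^ 2))
    ((p %| x) * (p %| y) + (x == 0%R) + (y == 0%R)) <= 3 * p ^ 2)%N.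
  under eq_bigr do rewrite !big_split /= -big_distrr /= sum0 sum_nat_const cardZ.
  rewrite !big_split /= -big_distrl -big_distrr /= sum0 sum_nat_const cardZ muln1.
  rewrite !mulSn mul0n addn0 addnA !leq_add2r expnS expn1.
  by rewrite leq_mul ?card_dvdn_Zp2.
apply: leq_trans; apply: leq_sum => x _; apply: leq_sum => y _.
have [xy|//] := boolP (adj x y).
have /or3P [/andP [-> ->] //|->|->] := annihilator_adj_Zp2 _ _ _ pp xy.
  by rewrite (leq_trans _ (leq_addr _ _)) // leq_addl.
by rewrite leq_addl.
Qed.

Theorem theorem7 (p : nat) (hp : prime p) (hp7 : (7 <= p)%N) :
  exists G : sgraph,
    [/\ #|G| = (p ^ 2)%N,
        connected G,
        threshold G,
        energy (annihilator_graph 'Z_(p ^ 2)) < energy G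
      & energy G < energy (complete_graph (p ^ 2))].
Proof.
have n49 : (49 <= p ^ 2)%N by rewrite -[49%N]/(7 ^ 2)%N leq_exp2r.
have p2 := prime_sqr_gt1 _ hp.
have [m nE] : exists m, (p ^ 2 = m.+3)%N by exists (p ^ 2 - 3)%N; lia.
exists (near_complete_graph m.+1); split.
- by rewrite card_ord nE.
- exact: connected_near_complete.
- exact: threshold_near_complete.
- apply: lt_le_trans (energy_near_complete_ge m.+1).
  rewrite -(ltr_pXn2r (n := 2)) ?nnegrE ?sumr_ge0 //.
  apply: le_lt_trans (energy_sqr_le _) _.
  have := sum_annihilator_adj_Zp2 _ hp.
  rewrite -natrX ltr_nat [#|_|]card_ord Zp_cast // nE => edges.
  (* With [n = m.+3], what remains is [3 n^2 < 4 (n - 3)^2], which follows from [49 <= n]. *)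
  apply: (@leq_ltn_trans (m.+3 * (3 * m.+3))%N); first by rewrite leq_mul2l edges orbT.
  by nia.
apply: lt_le_trans (energy_near_complete_lt m) _.
by apply: le_trans (energy_complete_graph_ge _); rewrite nE.
Qed.
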